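(* Let $G$ be a finite group. Then the difference subgroup graph $D(G)$ is connected if and only if $G$ is simple.
   Context: For a finite group $G$, the difference subgroup graph $D(G)$ is the undirected graph whose vertices are the non-trivial proper subgroups of $G$, with two distinct vertices $H$ and $K$ adjacent if and only if $\langle H,K\rangle = G$ and $HK\neq G$, where $HK=\{hk : h\in H,\ k\in K\}$.
   Formalization: The trivial group (null graph, counted as connected) and the groups whose difference subgroup graph is a single vertex (cyclic of order p^2) are excluded, since their graphs are connected although the groups are not simple. *)

(* Defs.v *)
From mathcomp Require Import all_boot all_fingroup all_solvable.

Set Implicit Arguments.
Unset Strict Implicit.
Unset Printing Implicit Defensive.

Local Open Scope group_scope.

Section DifferenceSubgroupGraph.

Variable gT : finGroupType.
Implicit Types G H K : {group gT}.

Definition diff_vertices G : {set {group gT}} :=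
  [set H : {group gT} | (H :!=: 1) && (H \proper G)].

(* H * K is the set product, not in general a subgroup. *)
Definition diff_adj G : rel {group gT} :=
  fun H K => [&& H \in diff_vertices G, K \in diff_vertices G, H != K,
                 H <*> K == G :> {set gT} & H * K != G :> {set gT}].

(* Any two vertices are joined by a walk; in particular the null graph and the
   one-vertex graph are connected. *)
Definition diff_connected G : Prop :=
  {in diff_vertices G &, forall H K, connect (diff_adj G) H K}.

End DifferenceSubgroupGraph.

(* Main.v *)
Require Import Defs.
From mathcomp Require Import all_boot all_fingroup all_solvable.

(** A proper nontrivial normal subgroup permutes with every subgroup, hence is an
    isolated vertex. Conversely let [G] be simple. If [H M <> G] with [M] maximal,
    then [H] is adjacent to a conjugate of [M], since the core of [M] is trivial
    and [H M^g = G] would force [H M = G]. Applied to [H <= M], this joins every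
    vertex to a maximal subgroup. A subgroup [P] whose order is the smallest prime
    divisor of [#|G|] never satisfies [P M = G], because [M] would then be normal;
    hence [P] is joined to every conjugacy class of maximal subgroups. Finally the
    conjugates of a maximal subgroup are pairwise adjacent. *)

Set Implicit Arguments.
Unset Strict Implicit.
Unset Printing Implicit Defensive.

Local Open Scope group_scope.

Section Adjacency.

Variable gT : finGroupType.
Implicit Types G H K M N P : {group gT}.

(** Writing [g = h * k ^ g] with [h] in [H] and [k] in [K] gives [g = k * h], so [K :^ g = K :^ h]
    and [H * K :^ g = (H * K) :^ h]. *)
Lemma mulGJ_eq G H K g :
  H \subset G -> g \in G -> H * K :^ g = G -> H * K = G.
Proof.
move=> sHG Gg defG.
have /mulsgP[h y Hh /imsetP[k Kk ->] eg]: g \in H * K :^ g by rewrite defG.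
have ekh : g = k * h.
  have /eqP: h * g^-1 * k = 1.
    by apply: (mulIg g); rewrite mul1g -!mulgA -conjgE -eg.
  by rewrite -eq_invg_mul invMg invgK => /eqP <-; rewrite mulgKV.
have Gh : h \in G := subsetP sHG h Hh.
move: defG; rewrite ekh conjsgM (conjGid Kk) -{1}(conjGid Hh) -conjsMg => defG.
by apply: (can_inj (conjsgK h)); rewrite defG conjGid.
Qed.

Lemma mulGJ_neq G H g : H \proper G -> g \in G -> H * H :^ g != G.
Proof.
move=> /andP[sHG not_sGH] Gg; apply: contraNneq not_sGH => /(mulGJ_eq sHG Gg).
by rewrite mulGid => ->.
Qed.

Lemma diff_adj_sym G : symmetric (diff_adj G).
Proof.
have mulC H K : H * K = G -> K * H = G.
  move=> defG; have /comm_group_setP <- // : group_set (H * K).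
  by rewrite defG groupP.
move=> H K; rewrite /diff_adj eq_sym joingC andbCA; congr [&& _, _, _, _ & ~~ _].
by apply/eqP/eqP; apply: mulC.
Qed.

Lemma diff_vertexJ G H g :
  g \in G -> ((H :^ g)%G \in diff_vertices G) = (H \in diff_vertices G).
Proof.
by move=> Gg; rewrite !inE -!cardG_gt1 cardJg -{1}(conjGid Gg) properJ.
Qed.

Lemma diff_adj_maximal G H M :
    H \in diff_vertices G -> M \in diff_vertices G -> maximal M G ->
    ~~ (H \subset M) -> H * M != G ->
  diff_adj G H M.
Proof.
move=> vH vM maxM not_sHM neHM; apply/and5P; split=> //.
  by apply: contraNneq not_sHM => ->.
have [sMG maxM'] := maxgroupP maxM.
have /setIdP[_ /proper_sub sHG] := vH.
rewrite eqEsubset join_subG sHG (proper_sub sMG) /=.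
apply: contraR not_sHM => not_sGJ.
have prJ : H <*> M \proper G.
  by rewrite properE join_subG sHG (proper_sub sMG).
by rewrite -(maxM' _ prJ (joing_subr _ _)) joing_subl.
Qed.

(** A walk rather than an edge, since [g] may normalise [M]. *)
Lemma maximal_connectJ G M g :
    M \in diff_vertices G -> maximal M G -> g \in G ->
  connect (diff_adj G) M (M :^ g)%G.
Proof.
move=> vM maxM Gg; have [sMMg | not_sMMg] := boolP (M \subset M :^ g).
  suff <- : M = (M :^ g)%G by [].
  by apply/val_inj/eqP; rewrite /= eqEcard sMMg cardJg leqnn.
have /setIdP[_ prM] := vM.
apply/connect1/diff_adj_maximal; rewrite ?diff_vertexJ //.
  by rewrite -(conjGid Gg) maximalJ.
exact: mulGJ_neq.
Qed.

Lemma simple_connect_maximal G H M :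
    simple G -> H \in diff_vertices G -> M \in diff_vertices G ->
    maximal M G -> H * M != G ->
  connect (diff_adj G) H M.
Proof.
move=> /simpleP[_ simG] vH vM maxM neHM.
have /setIdP[ntH prH] := vH; have /setIdP[_ prM] := vM.
have [g Gg not_sHMg] : exists2 g, g \in G & ~~ (H \subset M :^ g).
  apply/exists_inP; rewrite -negb_forall_in; apply/forall_inP=> sHMg.
  have sHcore : H \subset gcore M G by apply/bigcapsP.
  have [] := simG _ (gcore_normal (proper_sub prM)) => core.
    by case/negP: ntH; rewrite -subG1 -core.
  by case/andP: prM => _ /negP[]; rewrite -{1}core gcore_sub.
apply: connect_trans (_ : connect _ (M :^ g)%G M); last first.
  by rewrite (sym_connect_sym (@diff_adj_sym G)) maximal_connectJ.
apply/connect1/diff_adj_maximal; rewrite ?diff_vertexJ //.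
  by rewrite -(conjGid Gg) maximalJ.
by apply: contraNneq neHM => /(mulGJ_eq (proper_sub prH) Gg) ->.
Qed.

(* If [M] differs from [M :^ g], then [#|M : M :&: M :^ g|] is at least the least
   prime divisor of [#|G|], so counting gives [M * M :^ g = G]. *)
Lemma index_pdiv_normal G M :
  M \proper G -> #|G : M| = pdiv #|G| -> M <| G.
Proof.
move=> prM iM; have sMG := proper_sub prM.
apply/andP; split=> //; apply/subsetP=> g Gg; apply/normP.
have [sMMg | not_sMMg] := boolP (M \subset M :^ g).
  by apply/esym/eqP; rewrite eqEcard sMMg cardJg leqnn.
have sMgG : M :^ g \subset G by rewrite -(conjGid Gg) conjSg.
case/negP: (mulGJ_neq prM Gg); rewrite eqEcard mul_subG //=.
rewrite -(leq_pmul2r (cardG_gt0 (M :&: M :^ g))) -mul_cardG cardJg.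
rewrite -(Lagrange sMG) iM -mulnA leq_pmul2l //.
rewrite -(LagrangeI M (M :^ g)) mulnC leq_pmul2l //.
apply: pdiv_min_dvd; first by rewrite indexg_gt1.
exact: dvdn_trans (dvdn_indexg _ _) (cardSg sMG).
Qed.

Lemma simple_mul_pdiv_neq G P M :
    simple G -> #|P| = pdiv #|G| -> M \in diff_vertices G -> P * M != G.
Proof.
move=> /simpleP[ntG simG] oP /setIdP[ntM prM]; apply/eqP=> defG.
have r_pr : prime (pdiv #|G|) by rewrite pdiv_prime // cardG_gt1.
have iM : #|G : M| = pdiv #|G|.
  have dv : #|G : M| %| pdiv #|G|.
    (* As [P * M] is a group, [#|G : M|] equals [#|P : P :&: M|], a divisor of [#|P|]. *)
    have /comm_group_setP cPM : group_set (P * M) by rewrite defG groupP.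
    by rewrite -oP -{1}defG cPM indexMg -indexgI dvdn_indexg.
  apply/eqP; move/primeP: r_pr => [_ /(_ _ dv)/orP[|//]].
  by rewrite indexg_eq1; case/andP: prM => _ /negPf->.
have [eM | eM] := simG _ (index_pdiv_normal prM iM).
  by rewrite eM eqxx in ntM.
by rewrite eM properxx in prM.
Qed.

Lemma simple_diff_connected G : simple G -> diff_connected G.
Proof.
move=> simG H K vH vK; have [ntG _] := simpleP _ simG.
have [P sPG oP] : exists2 P : {group gT}, P \subset G & #|P| = pdiv #|G|.
  have [x Gx ox] := Cauchy (pdiv_prime (etrans (cardG_gt1 G) ntG)) (pdiv_dvd _).
  by exists <[x]>%G; rewrite ?cycle_subG.
have to_P X : X \in diff_vertices G -> connect (diff_adj G) X P.
  move=> vX; have /setIdP[ntX prX] := vX.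
  have [M maxM sXM] : {M : {group gT} | maximal M G & X \subset M}.
    have [M maxM sXM] := maxgroup_exists (gP := fun M => M \proper G) prX.
    by exists M.
  have prM := maxgroupp maxM.
  have vM : M \in diff_vertices G by rewrite inE prM (subG1_contra sXM).
  (* The vertex [X] makes [P] proper, as [#|P| <= #|X| < #|G|]; if [#|G|] is prime, then [P = G] and
     there is no vertex. *)
  have vP : P \in diff_vertices G.
    have r_pr : prime (pdiv #|G|) by rewrite pdiv_prime // cardG_gt1.
    rewrite inE -cardG_gt1 oP prime_gt1 //= properEcard sPG oP /=.
    apply: leq_ltn_trans (proper_card prX).
    by rewrite pdiv_min_dvd ?cardG_gt1 ?cardSg ?(proper_sub prX).
  apply: (@connect_trans _ _ M).
    apply: simple_connect_maximal => //; rewrite (mulSGid sXM).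
    by case/andP: prM => _; apply: contraNneq => ->.
  rewrite (sym_connect_sym (@diff_adj_sym G)).
  by apply: simple_connect_maximal; rewrite ?simple_mul_pdiv_neq.
apply: connect_trans (to_P H vH) _.
by rewrite (sym_connect_sym (@diff_adj_sym G)) to_P.
Qed.

(** As [H] normalises [N], the join [N <*> H] is the product [N * H]. *)
Lemma normal_diff_isolated G N H :
  N <| G -> ~~ diff_adj G N H.
Proof.
case/andP=> _ nNG; apply/and5P=> -[_ /setIdP[_ /proper_sub sHG] _ /eqP gen].
by rewrite -norm_joinEr ?gen ?eqxx //; apply: subset_trans nNG.
Qed.

End Adjacency.

(* The hypotheses remove the trivial group (null graph, hence connected, but G
   is not simple) and the groups whose graph is a single vertex, i.e. the cyclic
   groups of order p ^ 2 (connected, but G is not simple). *)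
Theorem theorem2p1 (gT : finGroupType) (G : {group gT})
    (ntG : G :!=: 1%g) (D_not_K1 : #|diff_vertices G| != 1%N) :
  diff_connected G <-> simple G.
Proof.
split=> [conn|]; last exact: simple_diff_connected.
apply/simpleP; split=> // N nNG.
have [-> | ntN] := eqVneq (N :> {set gT}) 1; first by left.
right; apply/eqP; apply: contraR D_not_K1 => neNG.
have vN : N \in diff_vertices G by rewrite inE ntN properEneq neNG normal_sub.
apply/cards1P; exists N; apply/setP=> K; rewrite inE.
apply/idP/eqP=> [vK | -> //].
(* A nonempty walk from [N] would start with an edge at [N], so only [K = N] remains. *)
have /connectP[[|X p] /=] := conn N K vN vK; first by [].
by rewrite (negPf (normal_diff_isolated X nNG)).
Qed.
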